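(* Every finite simple graph $G$ without isolated vertices is universal local antimagic orientable: for every set $L$ of $|E(G)|$ distinct positive real numbers, there exist an orientation $D$ of $G$ and a bijection $\tau: E(G)\to L$ such that for every pair of adjacent vertices $u,v$ of $G$, $s_{(D,\tau)}(u)\neq s_{(D,\tau)}(v)$.
   Context: For a graph $G$ with an orientation $D$ of its edges and a labeling $\tau: E(G)\to \mathbb{R}$, the vertex sum $s_{(D,\tau)}(v)$ of a vertex $v$ is the sum of the labels of the edges directed into $v$ minus the sum of the labels of the edges directed out of $v$. A graph $G$ is called universal local antimagic orientable if for every set $L$ of $|E(G)|$ positive real numbers there exist an orientation $D$ and a bijection $\tau:E(G)\to L$ such that any two adjacent vertices have distinct vertex sums. *)

(* Defs.v *)
From HB Require Import structures.
From mathcomp Require Import all_boot all_order all_algebra finmap reals.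

Set Implicit Arguments.
Unset Strict Implicit.
Unset Printing Implicit Defensive.

Import Order.TTheory GRing.Theory Num.Theory.
Local Open Scope ring_scope.

Record sgraph := SGraph {
  vertex :> finType;
  adj : rel vertex;
  adj_sym : symmetric adj;
  adj_irrefl : irreflexive adj
}.

Definition isolated (G : sgraph) (v : G) : Prop := forall u : G, ~~ adj v u.

Definition edges (G : sgraph) : {set {set G}} :=
  [set E | [exists x, exists y, adj x y && (E == [set x; y])]].

Definition edge (G : sgraph) : finType := {E : {set G} | E \in edges G}.

(* An orientation is given by the head of each edge: [D E] is the endpoint of
   [E] that [E] is directed into; [E] is directed out of its other endpoint. *)
Definition is_orientation (G : sgraph) (D : edge G -> G) : Prop :=
  forall E : edge G, D E \in val E.

Definition directed_into (G : sgraph) (D : edge G -> G) (E : edge G) (v : G) :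
  bool := D E == v.

Definition directed_out_of (G : sgraph) (D : edge G -> G) (E : edge G) (v : G) :
  bool := (v \in val E) && (D E != v).

Definition vertex_sum (R : realType) (G : sgraph) (D : edge G -> G)
    (tau : edge G -> R) (v : G) : R :=
  \sum_(E : edge G | directed_into D E v) tau E
  - \sum_(E : edge G | directed_out_of D E v) tau E.

(* [L] is a finite set, so its elements are distinct; a map [tau : edge G -> L]
   takes values in the subtype of elements of [L], injected in [R] by [val]. *)
Definition universal_local_antimagic_orientable (R : realType) (G : sgraph) :
    Prop :=
  forall L : {fset R},
    #|` L| = #|edges G| ->
    (forall x : R, x \in L -> 0 < x) ->
    exists (D : edge G -> G) (tau : edge G -> L),
      [/\ is_orientation D,
          bijective tau
        & forall u v : G, adj u v ->
            vertex_sum D (fun E => val (tau E)) u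
            <> vertex_sum D (fun E => val (tau E)) v].

(* Main.v *)
(** Fix any bijection [tau] from the edges to the labels and choose an
    orientation maximising the sum of the squares of the vertex sums.  If two
    adjacent vertices had the same sum [s], reversing the edge between them,
    with label [a], would replace [2 * s ^ 2] by
    [(s + 2 * a) ^ 2 + (s - 2 * a) ^ 2 = 2 * s ^ 2 + 8 * a ^ 2] in that sum. *)
Require Import Defs.
From mathcomp Require Import all_boot all_order all_algebra finmap reals.
From mathcomp Require Import ring lra.

Set Implicit Arguments.
Unset Strict Implicit.
Unset Printing Implicit Defensive.

Import Order.TTheory GRing.Theory Num.Theory.
Local Open Scope ring_scope.

Lemma bijective_of_card (T U : finType) :
  #|T| = #|U| -> exists f : T -> U, bijective f.
Proof.
move=> cTU; exists (fun x => enum_val (cast_ord cTU (enum_rank x))).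
exists (fun y => enum_val (cast_ord (esym cTU) (enum_rank y))) => x.
  by rewrite enum_valK cast_ordK enum_rankK.
by rewrite enum_valK cast_ordKV enum_rankK.
Qed.

Section Reversal.
Variables (R : realType) (G : sgraph).
Implicit Types (D : {ffun edge G -> G}) (t : edge G -> R).

(** Finite functions form a finite type, so the energy can be maximised over orientations; this
    provides the starting point that the maximum requires. *)
Lemma orientation_exists : exists D : {ffun edge G -> G}, is_orientation D.
Proof.
have nonempty (E : edge G) : exists x, x \in val E.
  have /[!inE] /existsP[x /existsP[y /andP[_ /eqP ->]]] := valP E.
  by exists x; rewrite set21.
by exists [ffun E => xchoose (nonempty E)] => E; rewrite ffunE; apply: xchooseP.
Qed.

(** For an orientation [D], this is the signed incidence matrix: 1 at the head of [E], -1 at its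
    tail, 0 elsewhere. *)
Definition incidence D (E : edge G) (w : G) : R :=
  (directed_into D E w)%:R - (directed_out_of D E w)%:R.

Lemma vertex_sumE D t w :
  vertex_sum D t w = \sum_E t E * incidence D E w.
Proof.
rewrite /vertex_sum big_mkcond [X in _ - X]big_mkcond -sumrB.
apply: eq_bigr => E _; rewrite /incidence.
by case: directed_into; case: directed_out_of => /=; ring.
Qed.

(** A reversal of [e] when [u] is its tail; naming the new head avoids computing the other
    endpoint. *)
Definition redirect D (e : edge G) (u : G) : {ffun edge G -> G} :=
  [ffun E => if E == e then u else D E].

Lemma redirect_orientation D (e : edge G) u :
  is_orientation D -> u \in val e -> is_orientation (redirect D e u).
Proof. by move=> oD ue E; rewrite ffunE; case: eqP => [->|]. Qed.

(** In the incidence form of the vertex sum, only the term of [e] depends on the head of [e]. *)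
Lemma vertex_sum_redirect D t e u w :
  vertex_sum (redirect D e u) t w =
  vertex_sum D t w + t e * (incidence (redirect D e u) e w - incidence D e w).
Proof.
rewrite !vertex_sumE (bigD1 e) //= [in RHS](bigD1 e) //=.
rewrite (eq_bigr (fun E => t E * incidence D E w)) => [|E /negPf neE].
  by ring.
by rewrite /incidence /directed_into /directed_out_of ffunE neE.
Qed.

Definition energy D t : R := \sum_w vertex_sum D t w ^+ 2.

Lemma energy_redirect D t (e : edge G) u v :
    val e = [set u; v] -> u != v -> D e = v -> 0 < t e ->
    vertex_sum D t u = vertex_sum D t v ->
  energy D t < energy (redirect D e u) t.
Proof.
move=> eE neq_uv Dev te_gt0 suv; have neq_vu : v != u by rewrite eq_sym.
(* The incidence of [e] passes from -1 to 1 at [u], and from 1 to -1 at [v]; hence the factor 2. *)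
have su : vertex_sum (redirect D e u) t u = vertex_sum D t u + 2 * t e.
  rewrite vertex_sum_redirect /incidence /directed_into /directed_out_of.
  rewrite ffunE eqxx Dev eE !inE !eqxx (negPf neq_vu) /=; ring.
have sv : vertex_sum (redirect D e u) t v = vertex_sum D t v - 2 * t e.
  rewrite vertex_sum_redirect /incidence /directed_into /directed_out_of.
  rewrite ffunE eqxx Dev eE !inE !eqxx neq_uv (negPf neq_uv) orbT /=; ring.
rewrite /energy (bigD1 u) // (bigD1 v) //= [ltRHS](bigD1 u) // (bigD1 v) //=.
rewrite [X in _ < _ + (_ + X)](eq_bigr (fun w => vertex_sum D t w ^+ 2)).
  rewrite su sv suv; set s := vertex_sum D t v.
  (* After expansion the two energies differ by 8 times this product. *)
  have : 0 < t e * t e by rewrite mulr_gt0.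
  by set S := \sum_(i | _) _; nra.
(* Off the endpoints of [e], its incidence is 0 both before and after the reversal. *)
move=> w /andP[neq_wu neq_wv]; rewrite vertex_sum_redirect.
rewrite /incidence /directed_into /directed_out_of ffunE eqxx Dev eE !inE.
rewrite [u == w]eq_sym [v == w]eq_sym (negPf neq_wu) (negPf neq_wv) /=.
by rewrite !subrr mulr0 addr0.
Qed.

End Reversal.

Theorem theorem1 (R : realType) (G : sgraph)
    (no_isolated : forall v : G, ~ isolated v) :
  universal_local_antimagic_orientable R G.
Proof.
move=> L cardL L_gt0.
have [tau bij_tau] : exists tau : edge G -> L, bijective tau.
  by apply: bijective_of_card; rewrite card_sig -cardfE cardL; apply: eq_card.
pose t E := val (tau E).
have t_gt0 E : 0 < t E by apply: L_gt0; apply: valP.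
pose oriented (D : {ffun edge G -> G}) := [forall E, D E \in val E].
have [D0 /forallP oD0] := orientation_exists G.
case: (@arg_maxP _ _ _ D0 oriented (fun D => energy D t) oD0).
move=> D /forallP oD maxD.
exists D, tau; split=> // u v.
have no_tie (x y : G) (e : edge G) : val e = [set x; y] -> x != y -> D e = y ->
    vertex_sum D t x <> vertex_sum D t y.
  move=> eE neq_xy Dey sxy.
  have := energy_redirect eE neq_xy Dey (t_gt0 e) sxy.
  rewrite ltNge => /negP; apply; apply: maxD; apply/forallP.
  by apply: redirect_orientation => //; rewrite eE set21.
move=> adj_uv.
have neq_uv : u != v by apply: contraTneq adj_uv => ->; rewrite adj_irrefl.
have uvE : [set u; v] \in edges G.
  rewrite inE; apply/existsP; exists u; apply/existsP; exists v.
  by rewrite adj_uv /=.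
pose e : edge G := exist _ [set u; v] uvE.
(* [no_tie] wants the head of the edge in second place, so a head at [u] calls for exchanging [u]
   and [v]. *)
have := oD e; rewrite !inE => /orP[] /eqP De; last exact: (no_tie _ _ e).
by apply/nesym; apply: (no_tie _ _ e) => //; [apply: setUC | rewrite eq_sym].
Qed.
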